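(* Let $n\ge3$ and let $X\sim\mathrm{ERGM}(\beta)$ with $k=2$, $H_1$ a single edge, $H_2$ a triangle, $\beta=(\beta_1,\beta_2)$, $\beta_1\in\mathbb{R}$, and $|\beta_2|<1/3$. Then there is a unique $a^*\in[0,1]$ satisfying $a^*=\varphi(a^* )$, and for $Z$ having the Erdős–Rényi distribution with parameter $a^*$, and any $h:\{0,1\}^{\binom n2}\to\mathbb{R}$, $$\left|\mathbb{E}h(X)-\mathbb{E}h(Z)\right|\le\|\Delta h\|\binom n2\left(4(1-3|\beta_2|)\right)^{-1}\frac{6a^*\sqrt{1-(a^* )^2}\,|\beta_2|}{\sqrt{n-2}}.$$
   Context: Vertex-labeled simple graphs on $\{1,\dots,n\}$ are identified with vectors $x=(x_{ij})_{1\le i<j\le n}\in\{0,1\}^{\binom n2}$, where $x_{ij}=1$ means there is an edge between $i$ and $j$. For a graph $H$, $t(H,x)$ is the number of edge-preserving injections from $V(H)$ to $\{1,\dots,n\}$: injections $\sigma$ such that $x_{\sigma(v)\sigma(w)}=1$ (indices ordered increasingly) for every edge $vw$ of $H$. Here $t_1(x)=t(H_1,x)$ (twice the number of edges of $x$) and $t_2(x)=t(H_2,x)/n$, and $X\sim\mathrm{ERGM}(\beta)$ means $\mathbb{P}(X=x)=\frac1{\kappa_n(\beta)}\exp\left(\beta_1t_1(x)+\beta_2t_2(x)\right)$ for $x\in\{0,1\}^{\binom n2}$, with $\kappa_n(\beta)$ the normalizing constant. $\Phi(a):=\beta_1+3\beta_2a^2$ and $\varphi(a):=\frac{1+\tanh(\Phi(a))}2=\frac{e^{2\Phi(a)}}{e^{2\Phi(a)}+1}$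 for $a\in[0,1]$. The Erdős–Rényi distribution with parameter $a$ on $\{0,1\}^{\binom n2}$ is the law of $\binom n2$ i.i.d. Bernoulli$(a)$ coordinates. For $h:\{0,1\}^{\binom n2}\to\mathbb{R}$ and a coordinate $ij$, $\Delta_{ij}h(x):=h(x^{(ij,1)})-h(x^{(ij,0)})$, where $x^{(ij,1)}$, $x^{(ij,0)}$ are $x$ with coordinate $ij$ set to $1$, $0$ respectively; $\|\Delta h\|:=\sup_{ij}\sup_x|\Delta_{ij}h(x)|$. *)

(* Defs.v *)
From HB Require Import structures.
From mathcomp Require Import all_boot all_order all_algebra.
From mathcomp Require Import all_classical all_reals all_analysis.

Set Implicit Arguments.
Unset Strict Implicit.
Unset Printing Implicit Defensive.

Import Order.TTheory GRing.Theory Num.Theory.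

Local Open Scope classical_set_scope.
Local Open Scope ring_scope.

Record sgraph := SGraph {
  vertex :> finType;
  adj : rel vertex;
  adj_sym : symmetric adj;
  adj_irr : irreflexive adj }.

Lemma neq_sym (T : eqType) : symmetric (fun i j : T => i != j).
Proof. by move=> i j; rewrite eq_sym. Qed.

Lemma neq_irr (T : eqType) : irreflexive (fun i j : T => i != j).
Proof. by move=> i; rewrite eqxx. Qed.

Definition complete_graph (k : nat) : sgraph :=
  @SGraph 'I_k _ (@neq_sym 'I_k) (@neq_irr 'I_k).

Definition single_edge : sgraph := complete_graph 2.
Definition triangle : sgraph := complete_graph 3.

Definition coord (n : nat) := {ij : 'I_n * 'I_n | (ij.1 < ij.2)%N}.

Definition lgraph (n : nat) := {ffun coord n -> bool}.

(* The entry of x at the unordered pair {i, j}; false when i = j. *)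
Definition edge_in n (x : lgraph n) (i j : 'I_n) : bool :=
  [exists e : coord n, x e && ((val e == (i, j)) || (val e == (j, i)))].

Definition hom_inj (H : sgraph) n (x : lgraph n) : {set {ffun H -> 'I_n}} :=
  [set s : {ffun H -> 'I_n} | injectiveb s &&
    [forall v, forall w, adj v w ==> edge_in x (s v) (s w)]].

Definition tcount (H : sgraph) n (x : lgraph n) : nat := #|hom_inj H x|.

Definition set_coord n (x : lgraph n) (e : coord n) (b : bool) : lgraph n :=
  [ffun f => if f == e then b else x f].

Section Reals.
Variable R : realType.

Definition t1 n (x : lgraph n) : R := (tcount single_edge x)%:R.
Definition t2 n (x : lgraph n) : R := (tcount triangle x)%:R / n%:R.

Definition ergm_weight n (beta1 beta2 : R) (x : lgraph n) : R :=
  expR (beta1 * t1 x + beta2 * t2 x).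

Definition kappa n (beta1 beta2 : R) : R :=
  \sum_(x : lgraph n) ergm_weight beta1 beta2 x.

Definition ergm_pmf n (beta1 beta2 : R) (x : lgraph n) : R :=
  (kappa n beta1 beta2)^-1 * ergm_weight beta1 beta2 x.

Definition er_pmf n (a : R) (x : lgraph n) : R :=
  \prod_(e : coord n) bernoulli_pmf a (x e).

(* Measurability of X is with respect to the discrete sigma-algebra, which on
   the finite type [lgraph n] amounts to measurability of the point preimages. *)
Definition has_law d (T : measurableType d) (P : probability T R) n
    (X : T -> lgraph n) (p : lgraph n -> R) : Prop :=
  forall x : lgraph n,
    measurable (X @^-1` [set x]) /\ P (X @^-1` [set x]) = (p x)%:E.

Definition tanh (u : R) : R := (expR u - expR (- u)) / (expR u + expR (- u)).

Definition Phi (beta1 beta2 a : R) : R := beta1 + 3 * beta2 * a ^+ 2.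

Definition phi (beta1 beta2 a : R) : R := (1 + tanh (Phi beta1 beta2 a)) / 2.

Definition Delta n (h : lgraph n -> R) (e : coord n) (x : lgraph n) : R :=
  h (set_coord x e true) - h (set_coord x e false).

Definition Delta_norm n (h : lgraph n -> R) : R :=
  sup [set `|Delta h e x| | e in [set: coord n] & x in [set: lgraph n]].

End Reals.

(* Main.v *)
(* Conditionally on the other edges, the edge e of the ERGM is present with
   probability logistic (Phi_e), where Phi_e = beta1 + 3 beta2 W_e / n and W_e is
   the number of common neighbours of the end points of e; under the Erdos-Renyi
   law this probability is the constant a. The Glauber dynamics of the ERGM
   contracts max |Delta h| by the factor 1 - (1 - b (n - 2) / n) / N per step,
   with b = 3 |beta2| and N = 'C(n, 2). Iterating the one-step discrepancy under
   the Erdos-Renyi law bounds |E h(X) - E h(Z)| by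
   max |Delta h| * sum_e E |logistic (Phi_e) - a| / (1 - b (n - 2) / n).

   Bounding |logistic (Phi_e) - a| by (b / 2) |W_e / n - a^2| is not enough,
   since W_e / n has mean a^2 (n - 2) / n rather than a^2, and for a near 1
   this bias exceeds the standard deviation a sqrt(1 - a^2) / sqrt(n - 2) which is
   allowed in the theorem. When a^2 > 1/2, one uses in addition that the secant
   slopes of logistic at a are of order 1 - a, and the gain in the contraction
   rate from 1 - b to 1 - b (n - 2) / n. *)

Require Import Defs.
From HB Require Import structures.
From mathcomp Require Import all_boot all_order all_algebra.
From mathcomp Require Import all_classical all_reals all_analysis.
From mathcomp Require Import ring lra zify.

Set Implicit Arguments.
Unset Strict Implicit.
Unset Printing Implicit Defensive.

Import Order.TTheory GRing.Theory Num.Theory.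
Import numFieldNormedType.Exports.

Local Open Scope ring_scope.

(** * The logistic function and the fixed point *)

Section Logistic.
Variable R : realType.
Implicit Types a b u v x y : R.

(** The standard sigmoid evaluated at [2 * u]; hence the factor 2 in its derivative
    [2 * p * (1 - p)] and the Lipschitz constant 1/2. *)
Definition logistic u : R := (1 + tanh u) / 2.

Lemma expR_addN_gt0 u : 0 < expR u + expR (- u).
Proof. by rewrite addr_gt0 ?expR_gt0. Qed.

Lemma logisticE u : logistic u = expR u / (expR u + expR (- u)).
Proof.
have h : expR u + expR (- u) != 0 by rewrite gt_eqF ?expR_addN_gt0.
by rewrite /logistic /tanh; field.
Qed.

Lemma logistic_gt0 u : 0 < logistic u.
Proof. by rewrite logisticE divr_gt0 ?expR_gt0 ?expR_addN_gt0. Qed.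

Lemma logistic_lt1 u : logistic u < 1.
Proof.
by rewrite logisticE ltr_pdivrMr ?expR_addN_gt0 // mul1r ltrDl expR_gt0.
Qed.

Lemma is_derive_logistic u :
  is_derive u 1 logistic (2 * logistic u * (1 - logistic u)).
Proof.
have h v : expR v + expR (- v) != 0 by rewrite gt_eqF ?expR_addN_gt0.
have -> : logistic = (fun v => expR v * (expR v + expR (- v))^-1).
  by apply/funext => v; rewrite logisticE.
have dN : is_derive u 1 (fun v : R => expR (- v)) (- expR (- u)).
  have := @is_derive1_comp R expR -%R u (expR (- u)) (-1) _ _.
  by rewrite mulrN1; apply.
have dV := @is_deriveV R (fun v => expR v + expR (- v)) u _ 1 (h u)
  (is_deriveD (is_derive_expR u) dN).
apply: is_derive_eq (is_deriveM (is_derive_expR u) dV) _.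
rewrite /GRing.scale /=.
by field.
Qed.

Lemma continuous_logistic : continuous logistic.
Proof.
move=> u; apply/differentiable_continuous/derivable1_diffP.
exact: (@ex_derive _ _ _ _ _ _ _ (is_derive_logistic u)).
Qed.

Lemma logistic_lipschitz u v : `|logistic u - logistic v| <= `|u - v| / 2.
Proof.
wlog uv : u v / v <= u.
  by move=> hw; case: (leP v u) => [/hw//|/ltW/hw]; rewrite distrC (distrC v).
have [||c _ ->] := @MVT_segment R logistic
  (fun u => 2 * logistic u * (1 - logistic u)) v u uv.
- by move=> x _; exact: is_derive_logistic.
- by apply: continuous_subspaceT; exact: continuous_logistic.
rewrite normrM mulrC ler_wpM2l //.
have := logistic_gt0 c; have := logistic_lt1 c => h1 h0.
have := sqr_ge0 (2 * logistic c - 1); rewrite expr2 => sq.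
by rewrite ger0_norm; nra.
Qed.

Lemma tanhE u : tanh u = 2 * logistic u - 1.
Proof. by rewrite /logistic; field. Qed.

Lemma tanh_abs_le u : `|tanh u| <= `|u|.
Proof.
have l0 : logistic 0 = 1 / 2 by rewrite logisticE oppr0 expR0; field.
have := logistic_lipschitz u 0; rewrite l0 subr0 tanhE.
rewrite (_ : _ - 1 = 2 * (logistic u - 1 / 2)); last by field.
by rewrite normrM (ger0_norm (_ : 0 <= 2))//; lra.
Qed.

Lemma tanh_ge_min u y : 0 <= y -> - y <= u -> - y <= tanh u.
Proof.
move=> y0 yu; have := tanh_abs_le u.
case: (lerP 0 u) => u0.
  suff : 0 <= tanh u by move=> *; lra.
  rewrite /tanh divr_ge0 ?(ltW (expR_addN_gt0 _)) // subr_ge0 ler_expR.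
  by move=> *; lra.
by rewrite (ltr0_norm u0) ler_norml => /andP[] *; lra.
Qed.

(** The addition formula for [tanh], with [tanh v = 2 * a - 1] and
    [1 - tanh v ^+ 2 = 4 * a * (1 - a)]. It exhibits the factor [1 - a] in the secant slopes at
    [v]. *)
Lemma logisticB v u : let a := logistic v in
  0 < 1 + (2 * a - 1) * tanh u /\
  logistic (v + u) - a = 2 * a * (1 - a) * tanh u / (1 + (2 * a - 1) * tanh u).
Proof.
have hv := expR_gt0 v; have hv' := expR_gt0 (- v).
have hu := expR_gt0 u; have hu' := expR_gt0 (- u).
have pq : 0 < expR v * expR u by rewrite mulr_gt0.
have pq' : 0 < expR (- v) * expR (- u) by rewrite mulr_gt0.
have E : 1 + (2 * logistic v - 1) * tanh u =
   2 * (expR v * expR u + expR (- v) * expR (- u)) /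
   ((expR v + expR (- v)) * (expR u + expR (- u))).
  rewrite logisticE /tanh; field.
  by rewrite !gt_eqF ?expR_addN_gt0.
have D : 0 < 1 + (2 * logistic v - 1) * tanh u.
  by rewrite E divr_gt0 ?mulr_gt0 ?addr_gt0.
split=> //; rewrite E !logisticE /tanh opprD !expRD.
by field; rewrite !gt_eqF ?addr_gt0 ?mulr_gt0 ?addr_gt0.
Qed.

(** For [a >= 1/2] the denominator in [logisticB] is nondecreasing in [tanh x], so a one-sided bound
    on [x] controls it through [tanh x >= - y]; the numerator uses [|tanh x| <= |x|]. *)
Lemma logistic_secant v a x y : logistic v = a ->
    1 / 2 <= a -> 0 <= y -> (2 * a - 1) * y < 1 -> - y <= x ->
  `|logistic (v + x) - a| <= 2 * a * (1 - a) / (1 - (2 * a - 1) * y) * `|x|.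
Proof.
move=> va ha y0 hy yx; have [] := logisticB v x; rewrite va => D ->.
have a1 : a < 1 by rewrite -va logistic_lt1.
have T := tanh_ge_min y0 yx.
rewrite normrM normfV (gtr0_norm D) normrM ger0_norm; last by move=> *; nra.
have C0 : 0 <= 2 * a * (1 - a) by move=> *; nra.
have D' : 0 < 1 - (2 * a - 1) * y by move=> *; lra.
rewrite mulrAC ler_pM ?normr_ge0 ?tanh_abs_le//.
  by rewrite divr_ge0// ltW.
by rewrite ler_wpM2l// lef_pV2 ?posrE//; nra.
Qed.

End Logistic.

Section FixedPoint.
Variables (R : realType) (beta1 beta2 : R).
Hypothesis hbeta2 : `|beta2| < 1 / 3.

(** Existence is the intermediate value theorem for [phi b - b]. For uniqueness, [|phi c - phi b|]
    is at most [3 * |beta2| * (c + b) / 2] times [|c - b|], and this factor is below 1 since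
    [c + b <= 2]. *)
Lemma phi_fixpoint_unique : exists a : R,
  unique (fun b : R => 0 <= b <= 1 /\ b = phi beta1 beta2 b) a.
Proof.
have phiE b : phi beta1 beta2 b = logistic (Phi beta1 beta2 b) by [].
have cont : continuous (fun b : R => phi beta1 beta2 b - b).
  move=> b; apply: cvgB; last exact: cvg_id.
  apply: (@continuous_comp _ _ _ (Phi beta1 beta2) (@logistic R)); last first.
    exact: continuous_logistic.
  apply: cvgD; first exact: cvg_cst.
  by apply: cvgM; [exact: cvg_cst | exact: exprn_continuous].
have [|c c01 hc] := @IVT R _ 0 1 0 ler01 (continuous_subspaceT cont).
  rewrite ge_min le_max !phiE subr0 (ltW (logistic_gt0 _)) /=.
  by rewrite subr_le0 (ltW (logistic_lt1 _)) orbT.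
move: hc c01 => /eqP; rewrite subr_eq0 in_itv /= => /eqP hc c01.
exists c; split=> [//|b [b01 hb]].
have := logistic_lipschitz (Phi beta1 beta2 c) (Phi beta1 beta2 b).
rewrite -!phiE hc -hb (_ : Phi _ _ _ - _ = (3 * beta2 * (c + b)) * (c - b)); last first.
  by rewrite /Phi; ring.
rewrite normrM => H; apply/eqP; rewrite -subr_eq0 -normr_eq0.
have K : `|3 * beta2 * (c + b)| < 2.
  rewrite !normrM (ger0_norm (_ : 0 <= 3)) // (ger0_norm (_ : 0 <= c + b));
    last by lra.
  have : `|beta2| * (c + b) <= `|beta2| * 2 by rewrite ler_wpM2l//; lra.
  by move: hbeta2 => *; lra.
rewrite eq_le normr_ge0 andbT; rewrite leNgt; apply/negP => P.
by move=> *; nra.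
Qed.

End FixedPoint.

(** * Absorbing the bias *)

Section Optimization.
Variable R : realType.
Implicit Types a b c l p y z : R.

(** This is the third condition of [exists_secant_slope] for the slope given by [logistic_secant],
    with [z = a ^+ 2 * (1 - b)], after clearing denominators and dividing by [1 - a]. *)
Lemma secant_poly_bound a z : 1 / 2 <= a <= 1 -> 0 <= z <= a ^+ 2 ->
  16 * a ^+ 2 * (1 - a) * z <=
    (1 + a) * (1 - (2 * a - 1) * a ^+ 2 + (2 * a - 1) * z) ^+ 2.
Proof.
move=> /andP[a0 a1] /andP[z0 za].
have [K KE] : exists K, K = 1 - (2 * a - 1) * a ^+ 2 by eexists.
have KE' : K = (1 - a) * (1 + a + 2 * a ^+ 2) by rewrite KE; ring.
rewrite -KE.
have [a8|a8] := lerP a (4 / 5).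
  (* Away from [a = 1], the square is replaced by its tangent at 1, which is exact at
     [z = a ^+ 2]. *)
  have s : 2 * (K + (2 * a - 1) * z) - 1 <= (K + (2 * a - 1) * z) ^+ 2.
    by have := sqr_ge0 (K + (2 * a - 1) * z - 1); nra.
  have s' : (1 + a) * (2 * (K + (2 * a - 1) * z) - 1)
     <= (1 + a) * (K + (2 * a - 1) * z) ^+ 2 by rewrite ler_wpM2l//; lra.
  apply: le_trans s'.
  have e0 : 0 <= (1 + a) * (2 * K - 1).
    rewrite mulr_ge0 //; first by move=> *; lra.
    have q : a ^+ 2 <= 16 / 25 by move=> *; nra.
    have : (2 * a - 1) * a ^+ 2 <= 3 / 5 * (16 / 25) by rewrite ler_pM//; nra.
    by rewrite KE; lra.
  have e1 : 16 * a ^+ 4 * (1 - a) <= 1 + a.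
    (* The maximum of [a ^+ 3 * (1 - a)] is 27/256, attained at [a = 3/4]. *)
    have : 0 <= a * (27 - 256 * a ^+ 3 * (1 - a)).
      rewrite mulr_ge0//; first by move=> *; lra.
      rewrite (_ : _ - _ = (4 * a - 3) ^+ 2 * (16 * a ^+ 2 + 8 * a + 3)); last by ring.
      by rewrite mulr_ge0 ?sqr_ge0//; nra.
    by rewrite !exprS expr0; nra.
  (* Both sides are affine in [z], so the endpoints [0] and [a ^ 2] suffice. *)
  have a2 : 0 < a ^+ 2 by move=> *; nra.
  rewrite -subr_ge0 -(pmulr_rge0 _ a2).
  rewrite (_ : a ^+ 2 * _ = (a ^+ 2 - z) * ((1 + a) * (2 * K - 1)) +
    z * (1 + a - 16 * a ^+ 4 * (1 - a))); last by rewrite KE; ring.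
  by rewrite addr_ge0// mulr_ge0//; lra.
(* Near [a = 1] the arithmetic-geometric inequality is used instead: [K] carries a factor [1 - a]
   that cancels the one on the left, leaving a polynomial inequality in [a] alone. *)
have s : 4 * K * ((2 * a - 1) * z) <= (K + (2 * a - 1) * z) ^+ 2.
  by have := sqr_ge0 (K - (2 * a - 1) * z); nra.
have s' : (1 + a) * (4 * K * ((2 * a - 1) * z))
   <= (1 + a) * (K + (2 * a - 1) * z) ^+ 2 by rewrite ler_wpM2l//; lra.
apply: le_trans s'.
rewrite KE' -subr_ge0 (_ : _ - _ = 4 * z * (1 - a) *
  ((1 + a) * (1 + a + 2 * a ^+ 2) * (2 * a - 1) - 4 * a ^+ 2)); last by ring.
rewrite mulr_ge0 ?mulr_ge0//; first by move=> *; lra.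
have : a ^+ 2 * (4 / 5) <= a ^+ 2 * a by rewrite ler_wpM2l ?sqr_ge0// ltW.
by rewrite subr_ge0; nra.
Qed.

(** Used with [l = (2 * L) ^+ 2] for a secant slope [L] and [p = (n - 2) * (1 - b)]. On the left
    stand a variance term and a bias term; on the right the cross term [4 * p] of [(p + 2) ^+ 2],
    which comes from the gain in contraction rate, absorbs the bias. *)
Lemma variance_bias_bound a b l p : 0 <= b <= 1 -> 0 <= p -> 0 <= a <= 1 ->
    0 <= l <= 1 -> a ^+ 2 * (1 - b) * l <= 1 - a ^+ 2 ->
  l * (p ^+ 2 * (1 - a ^+ 2) + 4 * a ^+ 2 * (1 - b) * p)
    <= (1 - a ^+ 2) * (p + 2) ^+ 2.
Proof.
move=> /andP[b0 b1] p0 /andP[a0 a1] /andP[l0 l1] h.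
have c0 : 0 <= 1 - a ^+ 2 by move=> *; nra.
have h1 : a ^+ 2 * (1 - b) * l * (4 * p) <= (1 - a ^+ 2) * (4 * p).
  by rewrite ler_wpM2r//; lra.
have h2 : l * (p ^+ 2 * (1 - a ^+ 2)) <= p ^+ 2 * (1 - a ^+ 2).
  by rewrite ler_piMl// mulr_ge0 ?sqr_ge0.
have -> : l * (p ^+ 2 * (1 - a ^+ 2) + 4 * a ^+ 2 * (1 - b) * p) =
  l * (p ^+ 2 * (1 - a ^+ 2)) + a ^+ 2 * (1 - b) * l * (4 * p) by ring.
have -> : (1 - a ^+ 2) * (p + 2) ^+ 2 = p ^+ 2 * (1 - a ^+ 2) +
  (1 - a ^+ 2) * (4 * p) + 4 * (1 - a ^+ 2) by ring.
by move=> *; lra.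
Qed.

(* For [a^2 <= 1/2] the Lipschitz constant [1/2] does; beyond that the secant
   slope at [a] decays like [1 - a], which is what absorbs the bias. *)
Lemma exists_secant_slope v a b : logistic v = a -> 0 <= b < 1 ->
  exists L : R, [/\ 0 <= L, (2 * L) ^+ 2 <= 1,
    a ^+ 2 * (1 - b) * (2 * L) ^+ 2 <= 1 - a ^+ 2 &
    forall w, 0 <= w <= 1 -> forall s, `|s| = b ->
      `|logistic (v + s * (w - a ^+ 2)) - a| <= L * (b * `|w - a ^+ 2|)].
Proof.
move=> va /andP[b0 b1].
have a0 : 0 < a by rewrite -va logistic_gt0.
have a1 : a < 1 by rewrite -va logistic_lt1.
have half w s : `|s| = b ->
   `|logistic (v + s * (w - a ^+ 2)) - a| <= 1 / 2 * (b * `|w - a ^+ 2|).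
  move=> sb; have := logistic_lipschitz (v + s * (w - a ^+ 2)) v.
  by rewrite addrAC subrr add0r normrM sb va; lra.
have [a2|a2] := lerP (a ^+ 2) (1 / 2).
  exists (1 / 2); split=> [||| w _ s]; [by move=> *; lra|by move=> *; lra| |exact: half].
  have := mulr_ge0 b0 (sqr_ge0 a); nra.
have ha : 1 / 2 <= a by move=> *; nra.
(* [y] bounds how far [s * (w - a ^+ 2)] can fall below 0: it is at least [- b * a ^+ 2] if
   [w < a ^+ 2], and at least [- b * (1 - a ^+ 2)] otherwise, which is no lower because
   [a ^+ 2 > 1/2]. *)
have [y yE] : exists y, y = b * a ^+ 2 by eexists.
have y0 : 0 <= y by rewrite yE mulr_ge0// sqr_ge0.
have ya : y <= a ^+ 2 by rewrite yE ler_piMl ?sqr_ge0// ltW.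
have hy : (2 * a - 1) * y < 1.
  have : (2 * a - 1) * y <= 1 * y by rewrite ler_wpM2r//; lra.
  have : a ^+ 2 < 1 by rewrite expr_lt1// ltW.
  by move=> *; lra.
pose L := 2 * a * (1 - a) / (1 - (2 * a - 1) * y).
have L0 : 0 <= L.
  by rewrite divr_ge0 ?mulr_ge0 ?subr_ge0// ltW.
have hL : a ^+ 2 * (1 - b) * (2 * L) ^+ 2 <= 1 - a ^+ 2.
  have := @secant_poly_bound a (a ^+ 2 - y); rewrite ha (ltW a1) /=.
  have -> : 0 <= a ^+ 2 - y <= a ^+ 2 by apply/andP; split; lra.
  move=> /(_ isT isT).
  have -> : 1 - (2 * a - 1) * a ^+ 2 + (2 * a - 1) * (a ^+ 2 - y) =
    1 - (2 * a - 1) * y by ring.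
  have D : 0 < 1 - (2 * a - 1) * y by move=> *; lra.
  move=> H.
  rewrite /L (_ : _ * _ = 16 * a ^+ 2 * (1 - a) * (a ^+ 2 - y) * (1 - a) /
    (1 - (2 * a - 1) * y) ^+ 2); last first.
    by rewrite [X in a ^+ 2 - X]yE; field; rewrite gt_eqF.
  rewrite ler_pdivrMr ?exprn_gt0// (_ : (1 - a ^+ 2) * _ =
    (1 + a) * (1 - (2 * a - 1) * y) ^+ 2 * (1 - a)); last by ring.
  by rewrite ler_wpM2r//; lra.
have main w s : 0 <= w <= 1 -> `|s| = b ->
    `|logistic (v + s * (w - a ^+ 2)) - a| <= L * (b * `|w - a ^+ 2|).
  move=> /andP[w0 w1] sb; rewrite -[X in L * (X * _)]sb -normrM.
  apply: logistic_secant => //.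
  have : `|s| <= b by rewrite sb.
  rewrite ler_norml => /andP[s0 s1]; rewrite yE.
  have [wa|wa] := lerP 0 (w - a ^+ 2).
    have : - b * (w - a ^+ 2) <= s * (w - a ^+ 2) by rewrite ler_wpM2r.
    have : b * (w - a ^+ 2) <= b * a ^+ 2 by rewrite ler_wpM2l//; lra.
    by move=> *; lra.
  have : b * (w - a ^+ 2) <= s * (w - a ^+ 2) by rewrite ler_wnM2r// ltW.
  have : 0 <= b * w by rewrite mulr_ge0.
  by move=> *; lra.
have [hl|hl] := lerP ((2 * L) ^+ 2) 1.
  by exists L; split=> // w hw s hs; exact: main.
(* If [(2 * L) ^+ 2 > 1], the slope 1/2 is smaller than [L] and inherits the bound [hL]. *)
exists (1 / 2); split=> [||| w _ s]; [by move=> *; lra|by move=> *; lra| |exact: half].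
have : a ^+ 2 * (1 - b) * 1 <= a ^+ 2 * (1 - b) * (2 * L) ^+ 2.
  apply: ler_wpM2l (ltW hl); rewrite mulr_ge0 ?sqr_ge0// subr_ge0.
  exact: ltW.
by move=> *; lra.
Qed.

End Optimization.

(** * Comparison of Glauber dynamics *)

Section Glauber.
Variables (R : realType) (n : nat).
Local Notation E := (Defs.coord n).
Local Notation S := (lgraph n).
Implicit Types (e f : E) (x y : S) (h : S -> R) (b : bool).

Lemma set_coordE x e b f : set_coord x e b f = if f == e then b else x f.
Proof. by rewrite ffunE. Qed.

Lemma set_coord_id x e : set_coord x e (x e) = x.
Proof. by apply/ffunP => f; rewrite set_coordE; case: eqP => [->|]. Qed.

Lemma set_coord2 x e b b' : set_coord (set_coord x e b) e b' = set_coord x e b'.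
Proof. by apply/ffunP => f; rewrite !set_coordE; case: eqP. Qed.

Lemma set_coordC x e f b b' : e != f ->
  set_coord (set_coord x e b) f b' = set_coord (set_coord x f b') e b.
Proof.
move=> ef; apply/ffunP => g; rewrite !set_coordE.
by case: eqP => [->|//]; rewrite eq_sym (negPf ef).
Qed.

(** Pairs [x] with its flip at [e]; every pair occurs twice on the right, whence the division by 2.
    It reduces stationarity to a two-point identity. *)
Lemma sum_set_coord (F : S -> bool -> R) e :
  \sum_x F x (x e) = \sum_x \sum_b F (set_coord x e b) b / 2.
Proof.
under [RHS]eq_bigr do rewrite big_bool.
rewrite big_split /=.
pose flip x := set_coord x e (~~ x e).
have flipK : involutive flip.
  by move=> x; rewrite /flip set_coord2 set_coordE eqxx negbK set_coord_id.
pose G x := F (set_coord x e true) true / 2 + F (set_coord x e false) false / 2.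
have -> : \sum_x F x (x e) = \sum_x (F x (x e) + F (flip x) (flip x e)) / 2.
  rewrite -mulr_suml big_split /= [X in _ + X](reindex_inj (inv_inj flipK)) /=.
  under [X in _ + X]eq_bigr do rewrite flipK.
  by field.
rewrite -big_split; apply: eq_bigr => x _ /=.
rewrite /flip set_coordE eqxx; case: (boolP (x e)) => xe /=.
  by rewrite -{1}(set_coord_id x e) xe mulrDl.
by rewrite -{1}(set_coord_id x e) (negPf xe) mulrDl addrC.
Qed.

Definition mean (p : S -> R) h : R := \sum_x p x * h x.

Lemma mean_add p h h' :
  mean p (fun x => h x + h' x) = mean p h + mean p h'.
Proof. by rewrite /mean -big_split; apply: eq_bigr => x _; rewrite mulrDr. Qed.

Lemma mean_mulr p h c :
  mean p (fun x => h x * c) = mean p h * c.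
Proof. by rewrite /mean mulr_suml; apply: eq_bigr => x _; rewrite mulrA. Qed.

Lemma mean_sumr (I : Type) (r : seq I) (P : pred I) p
    (F : I -> S -> R) :
  mean p (fun x => \sum_(i <- r | P i) F i x) = \sum_(i <- r | P i) mean p (F i).
Proof.
by rewrite /mean exchange_big; apply: eq_bigr => x _; rewrite mulr_sumr.
Qed.

(** The expectation of [h] after resampling the edge [e], present with probability [q x]. *)
Definition site_update (q : S -> R) e h x : R :=
  q x * h (set_coord x e true) + (1 - q x) * h (set_coord x e false).

(** Detailed balance between the two states of the edge [e] under resampling. *)
Definition reversible (p : S -> R) (q : E -> S -> R) := forall e x,
  p (set_coord x e true) * (1 - q e x) = p (set_coord x e false) * q e x.

Definition site_free (q : E -> S -> R) :=
  forall e x b, q e (set_coord x e b) = q e x.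

Lemma mean_site_update p q e h : reversible p q -> site_free q ->
  mean p (site_update (q e) e h) = mean p h.
Proof.
move=> rev free; rewrite /mean.
rewrite (sum_set_coord (fun x _ => p x * site_update (q e) e h x) e).
rewrite (sum_set_coord (fun x _ => p x * h x) e).
apply: eq_bigr => x _; rewrite !big_bool /site_update !free !set_coord2.
have r := rev e x.
set p1 := p _ in r *; set p0 := p (set_coord x e false) in r *.
rewrite /= -[LHS]mulrDl -[RHS]mulrDl; congr (_ / 2).
set h1 := h _; set h0 := h _; set c := q e x in r *.
have -> : p1 * (c * h1 + (1 - c) * h0) + p0 * (c * h1 + (1 - c) * h0) =
  (p1 * c + p0 * c) * h1 + (p1 * (1 - c) + p0 * (1 - c)) * h0 by ring.
(* Detailed balance, used once in each direction, collapses the coefficients of [h1] and [h0] to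
   [p1] and [p0]. *)
by rewrite -r {2}r; ring.
Qed.

Definition glauber (q : E -> S -> R) h x : R :=
  (\sum_e site_update (q e) e h x) / #|{: E}|%:R.

Lemma mean_glauber p q h : (0 < #|{: E}|)%N -> reversible p q -> site_free q ->
  mean p (glauber q h) = mean p h.
Proof.
move=> E0 rev free; rewrite mean_mulr mean_sumr.
under eq_bigr do rewrite mean_site_update//.
by rewrite sumr_const -[X in X / _]mulr_natr mulfK// pnatr_eq0 -lt0n.
Qed.

(** Dobrushin contraction. Updating [e] itself erases the discrepancy at [e]; each of the other
    [N - 1] sites [f] keeps at most [d] and adds its influence times [d]. The total is
    [(N - 1 + eps) * d], divided by [N]. *)
Lemma Delta_glauber_le q h d eps : (0 < #|{: E}|)%N -> site_free q ->
    (forall e x, 0 <= q e x <= 1) ->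
    (forall e x, \sum_f `|Delta (q f) e x| <= eps) ->
    (forall e x, `|Delta h e x| <= d) ->
  forall e x, `|Delta (glauber q h) e x| <= (1 - (1 - eps) / #|{: E}|%:R) * d.
Proof.
move=> E0 free q01 qeps hd e x.
have d0 : 0 <= d := le_trans (normr_ge0 _) (hd e x).
have N0 : #|{: E}|%:R != 0 :> R by rewrite pnatr_eq0 -lt0n.
have term f : `|Delta (site_update (q f) f h) e x| <=
    (f != e)%:R * d + `|Delta (q f) e x| * d.
  rewrite /Delta /site_update; case: eqVneq => [->|fe].
    by rewrite !free !set_coord2 subrr normr0 mul0r add0r mulr_ge0.
  have ef : e != f by rewrite eq_sym.
  rewrite !(set_coordC _ _ _ ef) mul1r.
  set y1 := set_coord x f true; set y0 := set_coord x f false.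
  set a := q f _; set c := q f _.
  have /andP[a0 a1] : 0 <= a <= 1 := q01 _ _.
  (* The effect of [e] on [h] at a fixed update probability is separated from its effect on the
     probability, which is paid for by [Delta h f]. *)
  rewrite (_ : _ - _ = a * Delta h e y1 + (1 - a) * Delta h e y0 +
    (a - c) * Delta h f (set_coord x e false)); last first.
    by rewrite /Delta !(set_coordC _ _ _ ef) -/y1 -/y0; ring.
  apply: le_trans (ler_normD _ _) _; rewrite lerD//; last first.
    by rewrite normrM ler_wpM2l.
  apply: le_trans (ler_normD _ _) _.
  rewrite !normrM (ger0_norm a0) (ger0_norm (_ : 0 <= 1 - a)) ?subr_ge0//.
  have : a * `|Delta h e y1| <= a * d by rewrite ler_wpM2l.
  have : (1 - a) * `|Delta h e y0| <= (1 - a) * d by rewrite ler_wpM2l ?subr_ge0.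
  by move=> *; lra.
have -> : Delta (glauber q h) e x =
    (\sum_f Delta (site_update (q f) f h) e x) / #|{: E}|%:R.
  by rewrite /Delta /glauber -mulrBl -sumrB.
rewrite normrM normfV (ger0_norm (ler0n R _)) ler_pdivrMr ?ltr0n//.
apply: le_trans (ler_norm_sum _ _ _) _.
apply: le_trans (ler_sum _ (fun f _ => term f)) _.
rewrite big_split /= -!mulr_suml -natr_sum -[leLHS]mulrDl [leRHS]mulrAC ler_wpM2r//.
rewrite (_ : (\sum_i _)%N = #|{: E}|.-1); last first.
  rewrite -(cardC1 e) -sum1_card [RHS]big_mkcond; apply: eq_bigr => f _.
  by rewrite !inE; case: (f != e).
rewrite mulrBl mul1r divfK//.
have : (#|{: E}|.-1)%:R = #|{: E}|%:R - 1 :> R by rewrite -subn1 natrB.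
by have := qeps e x; lra.
Qed.

Lemma lipschitz_le h d : (forall e x, `|Delta h e x| <= d) ->
  forall x y, `|h x - h y| <= #|{: E}|%:R * d.
Proof.
move=> hd x y; have d0 e : 0 <= d := le_trans (normr_ge0 _) (hd e x).
(* One moves from [u] to [v] one coordinate at a time, along a list containing all coordinates where
   they differ. *)
suff path (s : seq E) (u v : S) : (forall e, e \notin s -> u e = v e) ->
    `|h u - h v| <= (size s)%:R * d.
  by have := path (enum {: E}) x y; rewrite -cardE; apply=> e; rewrite mem_enum.
elim: s u => [|e s IH] u huv.
  have -> : u = v by apply/ffunP => e; apply: huv.
  by rewrite subrr normr0 mul0r.
have step : `|h u - h (set_coord u e (v e))| <= d.
  have := hd e u; rewrite /Delta -{3}(set_coord_id u e).
  by case: (u e) (v e) => [] [] //; rewrite ?subrr ?normr0 ?(d0 e)// distrC.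
have := IH (set_coord u e (v e)).
have H f : f \notin s -> set_coord u e (v e) f = v f.
  move=> fs; rewrite set_coordE; case: eqVneq => [->//|fe].
  by apply: huv; rewrite inE negb_or fe.
move=> /(_ H) IHe; rewrite /= -natr1 mulrDl mul1r [leRHS]addrC.
by apply: le_trans (ler_distD (h (set_coord u e (v e))) _ _) _; rewrite lerD.
Qed.

Lemma mean_diff_le mu nu h c : mean mu (fun=> 1) = 1 -> mean nu (fun=> 1) = 1 ->
    (forall x, 0 <= mu x) -> (forall x, 0 <= nu x) ->
    (forall x y, `|h x - h y| <= c) -> `|mean mu h - mean nu h| <= c.
Proof.
move=> mu1 nu1 mu0 nu0 hc.
(* Integration of [h x - h y] against the product coupling of [mu] and [nu]. *)
have E : mean mu h - mean nu h = \sum_x \sum_y mu x * nu y * (h x - h y).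
  rewrite (eq_bigr (fun x => mu x * h x * mean nu (fun=> 1) - mu x * mean nu h)).
    by rewrite nu1 sumrB -!mulr_suml mulr1 -[\sum_i mu i]mulr1 mulr_suml
      -[X in _ - X * _]/(mean mu (fun=> 1)) mu1 mul1r.
  move=> x _; rewrite /mean !mulr_sumr -sumrB; apply: eq_bigr => y _; ring.
rewrite E; apply: le_trans (ler_norm_sum _ _ _) _.
rewrite (_ : c = mean mu (fun=> 1) * mean nu (fun=> 1) * c); last first.
  by rewrite mu1 nu1 !mul1r.
rewrite /mean big_distrlr mulr_suml; apply: ler_sum => x _.
apply: le_trans (ler_norm_sum _ _ _) _.
rewrite mulr_suml; apply: ler_sum => y _.
by rewrite !mulr1 normrM ger0_norm ?mulr_ge0// ler_wpM2l ?mulr_ge0.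
Qed.

(* Stationarity of [nu] under the [q']-dynamics replaces [mean nu h] by
   [mean nu (glauber q' h)]. *)
Lemma mean_glauber_defect nu q q' h d : (0 < #|{: E}|)%N ->
    (forall x, 0 <= nu x) -> reversible nu q' -> site_free q' ->
    (forall e x, `|Delta h e x| <= d) ->
  `|mean nu (glauber q h) - mean nu h| <=
    d / #|{: E}|%:R * \sum_e mean nu (fun x => `|q e x - q' e x|).
Proof.
move=> E0 nu0 rev free hd.
rewrite -[X in _ - X](mean_glauber h E0 rev free) !mean_mulr !mean_sumr -mulrBl -sumrB.
rewrite normrM normfV (ger0_norm (ler0n R _)) mulrAC ler_wpM2r ?invr_ge0 ?ler0n//.
rewrite mulr_sumr; apply: le_trans (ler_norm_sum _ _ _) _.
apply: ler_sum => e _; rewrite /mean -sumrB mulr_sumr.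
apply: le_trans (ler_norm_sum _ _ _) _; apply: ler_sum => x _.
rewrite (_ : _ - _ = nu x * ((q e x - q' e x) * Delta h e x)); last first.
  by rewrite /site_update /Delta; ring.
rewrite !normrM (ger0_norm (nu0 x)) [leRHS]mulrCA ler_wpM2l// mulrC ler_wpM2r//.
Qed.

(** Replacing [h] by [glauber q h] leaves its mean under [mu] unchanged, costs one defect under
    [nu], and shrinks the bound on [Delta h] by [rho]. Iteration sums a geometric series of
    defects. *)
Lemma glauber_comparison mu nu q q' eps h d : (0 < #|{: E}|)%N ->
    mean mu (fun=> 1) = 1 -> mean nu (fun=> 1) = 1 ->
    (forall x, 0 <= mu x) -> (forall x, 0 <= nu x) ->
    reversible mu q -> reversible nu q' -> site_free q -> site_free q' ->
    (forall e x, 0 <= q e x <= 1) -> 0 <= eps < 1 ->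
    (forall e x, \sum_f `|Delta (q f) e x| <= eps) ->
    (forall e x, `|Delta h e x| <= d) ->
  `|mean mu h - mean nu h| <=
    d / (1 - eps) * \sum_e mean nu (fun x => `|q e x - q' e x|).
Proof.
move=> E0 mu1 nu1 mu0 nu0 revq revq' free free' q01 /andP[eps0 eps1] qeps hd.
set C := \sum_e _; set N := #|{: E}|%:R : R.
have N1 : 1 <= N by rewrite ler1n.
have N0 : 0 < N by lra.
pose rho := 1 - (1 - eps) / N.
have rho01 : 0 <= rho < 1.
  rewrite /rho subr_ge0 ler_pdivrMr// gtrBl divr_gt0 ?subr_gt0//.
  by rewrite andbT; lra.
(* The induction needs all [h] and [d] at once, since its step passes to [glauber q h] and
   [rho * d]. At [k = 0] the crude bound [N * d] suffices. *)
have iter k : forall h d, (forall e x, `|Delta h e x| <= d) ->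
    `|mean mu h - mean nu h| <= d / (1 - eps) * C + rho ^+ k * (N * d).
  elim: k => [|k IH] {}h {}d {}hd.
    have d0 e x : 0 <= d := le_trans (normr_ge0 _) (hd e x).
    have C0 : 0 <= C.
      by apply: sumr_ge0 => e _; apply: sumr_ge0 => x _; rewrite mulr_ge0.
    have [e _] := card_gt0P E0.
    have D0 : 0 <= d := d0 e [ffun=> false].
    apply: le_trans (mean_diff_le mu1 nu1 mu0 nu0 (lipschitz_le hd)) _.
    by rewrite expr0 mul1r lerDr mulr_ge0// divr_ge0// subr_ge0 ltW.
  have := IH _ _ (Delta_glauber_le E0 free q01 qeps hd).
  rewrite (mean_glauber _ E0 revq free) -/N -/rho => A.
  have B := mean_glauber_defect q E0 nu0 revq' free' hd; rewrite -/C -/N in B.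
  apply: le_trans (ler_distD (mean nu (glauber q h)) _ _) _.
  apply: le_trans (lerD A B) _.
  (* The main term reproduces itself: [rho * d / (1 - eps) + d / N = d / (1 - eps)], because
     [1 - rho = (1 - eps) / N]. *)
  rewrite le_eqVlt; apply/orP; left; apply/eqP.
  rewrite /rho exprSr; field.
  by rewrite !gt_eqF// subr_gt0.
have cv : ((fun k => d / (1 - eps) * C + rho ^+ k * (N * d))%R @ \oo -->
    (d / (1 - eps) * C + 0 * (N * d))%R)%classic.
  apply: cvgD; first exact: cvg_cst.
  apply: cvgM; last exact: cvg_cst.
  by apply: cvg_expr; rewrite ger0_norm; case/andP: rho01.
rewrite -[leRHS]addr0 -[X in _ <= _ + X](mul0r (N * d)).
rewrite -(cvg_lim _ cv)//; apply: limr_ge; first by apply/cvg_ex; eexists; exact: cv.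
by near=> k; exact: iter.
Unshelve. all: by end_near.
Qed.

End Glauber.

(** * Edges, codegrees and subgraph counts *)

Section EdgeSets.
Variable n : nat.
Implicit Types (e f : Defs.coord n) (x : lgraph n) (i j k : 'I_n).

Definition joins e i j : bool := (val e == (i, j)) || (val e == (j, i)).

Lemma joins_sym e i j : joins e i j = joins e j i.
Proof. by rewrite /joins orbC. Qed.

Lemma joins_neq e i j : joins e i j -> i != j.
Proof.
by case/orP => /eqP E; have := valP e; rewrite E /= ltn_neqAle => /andP[];
  rewrite // eq_sym.
Qed.

Lemma joins_irr e i : joins e i i = false.
Proof. by apply/negbTE/negP => /joins_neq; rewrite eqxx. Qed.

Lemma joins_inj e f i j : joins e i j -> joins f i j -> e = f.
Proof.
move=> /orP[]/eqP E /orP[]/eqP F; apply: val_inj; rewrite ?E ?F//.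
  by have := valP e; have := valP f; rewrite E F /= => h /(ltn_trans h); rewrite ltnn.
by have := valP e; have := valP f; rewrite E F /= => h /(ltn_trans h); rewrite ltnn.
Qed.

Lemma joins_ex i j : i != j -> {e | joins e i j}.
Proof.
move=> ij; have [lt|ge] := ltnP i j.
  by exists (exist _ (i, j) lt); rewrite /joins eqxx.
have lt : (j < i)%N by rewrite ltn_neqAle eq_sym ij.
by exists (exist _ (j, i) lt); rewrite /joins eqxx orbT.
Qed.

Lemma joins_val e : joins e (val e).1 (val e).2.
Proof. by rewrite /joins -surjective_pairing eqxx. Qed.

Lemma joins_cases e i j i' j' : joins e i j -> joins e i' j' ->
  (i = i' /\ j = j') \/ (i = j' /\ j = i').
Proof.
by move=> /orP[]/eqP E /orP[]/eqP; rewrite E => -[-> ->]; auto.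
Qed.

Lemma edge_in_sym x i j : edge_in x i j = edge_in x j i.
Proof.
by apply: eq_existsb => e; rewrite -!/(joins _ _ _) joins_sym.
Qed.

Lemma edge_inE x e i j : joins e i j -> edge_in x i j = x e.
Proof.
move=> eij; rewrite /edge_in.
apply/idP/idP => [/fintype.existsP[f /andP[xf fij]]|xe]; last first.
  by apply/fintype.existsP; exists e; rewrite xe.
by rewrite (joins_inj eij fij).
Qed.

Lemma edge_in_irr x i : edge_in x i i = false.
Proof.
rewrite /edge_in; apply/negbTE/negP => /fintype.existsP[f /andP[_ /joins_neq]].
by rewrite eqxx.
Qed.

Lemma edge_in_set x e b i j :
  edge_in (set_coord x e b) i j = if joins e i j then b else edge_in x i j.
Proof.
have [->|ij] := eqVneq i j.
  by rewrite !edge_in_irr; case: ifP => // /joins_neq; rewrite eqxx.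
have [f fij] := joins_ex ij.
rewrite !(edge_inE _ fij) ffunE; case: eqVneq => [<-|fe]; first by rewrite fij.
by case: ifP => // /joins_inj/(_ fij) ef; rewrite ef eqxx in fe.
Qed.

Definition codegree e x : nat :=
  \sum_k (edge_in x (val e).1 k && edge_in x (val e).2 k).

Lemma codegree_joins e x i j : joins e i j ->
  codegree e x = (\sum_k (edge_in x i k && edge_in x j k))%N.
Proof.
rewrite /codegree => /orP[]/eqP -> //=.
by apply: eq_bigr => k _; rewrite andbC.
Qed.

(** The edge [e] joins an end point to [k] only if [k] is the other end point, and then the
    companion factor is a loop, hence false. *)
Lemma codegree_set e x b : codegree e (set_coord x e b) = codegree e x.
Proof.
apply: eq_bigr => k _; rewrite !edge_in_set.
have E := joins_val e; have ne := joins_neq E.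
case: ifP => [/(joins_cases E) [[_ h]|[_ h]]|_].
- rewrite -h edge_in_irr andbF; case: ifP => [/joins_neq|]; rewrite ?eqxx//.
  by rewrite andbF.
- by rewrite h eqxx in ne.
case: ifP => // /(joins_cases E) [[h _]|[h _]].
  by rewrite h eqxx in ne.
by rewrite -h edge_in_irr.
Qed.

Lemma codegree_le e x : (codegree e x <= n - 2)%N.
Proof.
have ne := joins_neq (joins_val e).
rewrite /codegree (bigD1 (val e).1)//= edge_in_irr add0n.
rewrite (bigD1 (val e).2) /=; last by rewrite eq_sym.
rewrite edge_in_irr andbF add0n.
apply: (@leq_trans (\sum_(k | (k != (val e).1) && (k != (val e).2)) 1)).
  by apply: leq_sum => k _; case: (_ && _).
rewrite sum1_card -[X in (_ <= X - _)%N]card_ord.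
rewrite -(cardC [set (val e).1; (val e).2]) cards2 ne addKn.
by apply/eq_leq/eq_card => k; rewrite !inE negb_or.
Qed.

End EdgeSets.

Section PairSums.
Variable n : nat.

Lemma sum_pairs_coord (R : nzRingType) (G : 'I_n -> 'I_n -> R) :
    (forall i j, G i j = G j i) ->
  \sum_i \sum_(j | i != j) G i j = 2 * \sum_(e : Defs.coord n) G (val e).1 (val e).2.
Proof.
move=> Gsym.
have -> : \sum_(e : Defs.coord n) G (val e).1 (val e).2 =
    \sum_(i : 'I_n) \sum_(j : 'I_n | (i < j)%N) G i j.
  rewrite pair_big_dep /=.
  rewrite (reindex_omap (fun e : Defs.coord n => val e) insub) /=; last first.
    by move=> p hp; rewrite insubT.
  by apply: eq_bigl => e; rewrite valK eqxx andbT; symmetry; exact: (valP e).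
rewrite mulr_natl mulr2n.
rewrite [X in _ = _ + X](exchange_big_dep predT) //= -big_split /=.
apply: eq_bigr => i _.
rewrite (bigID (fun j : 'I_n => (i < j)%N)) /=; congr (_ + _).
  by apply: eq_bigl => j; rewrite neq_ltn; case: (i < j)%N; rewrite ?orbT ?andbF.
rewrite (eq_bigr _ (fun j _ => Gsym i j)); apply: eq_bigl => j.
by rewrite -leqNgt (ltn_neqAle j i) eq_sym.
Qed.

Lemma card_coord : #|{: Defs.coord n}| = 'C(n, 2).
Proof.
have := @sum_pairs_coord int (fun _ _ => 1) (fun _ _ => erefl).
rewrite sumr_const (eq_bigr (fun=> n.-1%:R)); last first.
  move=> i _; rewrite sumr_const; congr (_ *+ _).
  by rewrite -[n in RHS]card_ord -(cardC1 i); apply: eq_card => j; rewrite !inE eq_sym.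
rewrite sumr_const card_ord => /esym; rewrite -[RHS]mulr_natr -!natrM => /eqP.
rewrite eqr_nat => /eqP H.
by rewrite bin2 [(n * _)%N]mulnC -H mul2n doubleK.
Qed.

End PairSums.

(** * Edge and triangle counts and their discrete derivatives *)

Section Counts.
Variables (R : realType) (n : nat).
Implicit Types (e f : Defs.coord n) (x : lgraph n) (i j k : 'I_n).

Lemma sum_joins e (F : 'I_n -> 'I_n -> R) :
  \sum_i \sum_j (joins e i j)%:R * F i j =
    F (val e).1 (val e).2 + F (val e).2 (val e).1.
Proof.
have ne := joins_neq (joins_val e).
have delta (p : 'I_n * 'I_n) : \sum_q (p == q)%:R * F q.1 q.2 = F p.1 p.2.
  rewrite (bigD1 p) //= eqxx mul1r big1 ?addr0// => q qp.
  by rewrite eq_sym (negPf qp) mul0r.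
rewrite pair_big /= -(delta (val e)) -(delta ((val e).2, (val e).1)) -big_split /=.
apply: eq_bigr => -[i j] _ /=; rewrite -mulrDl; congr (_ * _); rewrite /joins.
case: e ne => -[u v] h /= ne; rewrite !xpair_eqE [(u == j) && _]andbC.
have : ~~ [&& (u == i) && (v == j) & (v == i) && (u == j)].
  apply/negP => /andP[/andP[/eqP ui _] /andP[/eqP vi _]].
  by rewrite ui vi eqxx in ne.
by case: ((u == i) && _); case: ((v == i) && _) => //= _; rewrite ?addr0 ?add0r.
Qed.

Lemma codegreeE e x i j : joins e i j ->
  (codegree e x)%:R = \sum_k (edge_in x i k)%:R * (edge_in x j k)%:R :> R.
Proof.
move=> eij; rewrite (codegree_joins x eij) natr_sum.
by apply: eq_bigr => k _; rewrite -natrM mulnb.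
Qed.

(** Injectivity is automatic for complete graphs, because [x] has no loops. *)
Lemma hom_inj_completeE p x (s : {ffun 'I_p -> 'I_n}) :
  (s \in hom_inj (complete_graph p) x) =
  [forall v, forall w, (v != w) ==> edge_in x (s v) (s w)].
Proof.
rewrite inE; apply/andP/idP => [[]//|H]; split=> //.
apply/injectiveP => v w svw; apply/eqP/negPn/negP => vw.
by move/forallP/(_ v)/forallP/(_ w): H; rewrite vw svw edge_in_irr.
Qed.

Lemma tcount_single_edge x :
  (tcount single_edge x)%:R = \sum_i \sum_j (edge_in x i j)%:R :> R.
Proof.
pose o0 : 'I_2 := @Ordinal 2 0 isT; pose o1 : 'I_2 := @Ordinal 2 1 isT.
have I2 v : v = o0 \/ v = o1.
  by case: v => [[|[|]]]//= lt; [left|right]; apply: val_inj.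
pose tup (p : 'I_n * 'I_n) : {ffun 'I_2 -> 'I_n} :=
  [ffun v => if v == o0 then p.1 else p.2].
rewrite /tcount -sum1_card big_mkcond natr_sum pair_big /=.
rewrite (reindex tup) /=; last first.
  exists (fun s => (s o0, s o1)) => [[i j] _|s _]; first by rewrite !ffunE.
  by apply/ffunP => v; rewrite ffunE; case: (I2 v) => ->.
apply: eq_bigr => -[i j] _; rewrite hom_inj_completeE /=.
rewrite (_ : [forall v, _] = edge_in x i j); first by case: edge_in.
apply/forallP/idP => [/(_ o0)/forallP/(_ o1)|ij v]; first by rewrite !ffunE.
apply/forallP => w; apply/implyP; rewrite !ffunE.
by case: (I2 v) => ->; case: (I2 w) => -> //= _; rewrite // edge_in_sym.
Qed.

Lemma tcount_triangle x : (tcount triangle x)%:R =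
  \sum_i \sum_j \sum_k (edge_in x i j && edge_in x j k && edge_in x i k)%:R :> R.
Proof.
pose o0 : 'I_3 := @Ordinal 3 0 isT; pose o1 : 'I_3 := @Ordinal 3 1 isT.
pose o2 : 'I_3 := @Ordinal 3 2 isT.
have I3 v : [\/ v = o0, v = o1 | v = o2].
  by case: v => [[|[|[|]]]]//= lt; [apply: Or31|apply: Or32|apply: Or33]; apply: val_inj.
pose tup (p : 'I_n * 'I_n * 'I_n) : {ffun 'I_3 -> 'I_n} :=
  [ffun v => if v == o0 then p.1.1 else if v == o1 then p.1.2 else p.2].
rewrite /tcount -sum1_card big_mkcond natr_sum !pair_big /=.
rewrite (reindex tup) /=; last first.
  exists (fun s => (s o0, s o1, s o2)) => [[[i j] k] _|s _]; first by rewrite !ffunE.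
  by apply/ffunP => v; rewrite ffunE; case: (I3 v) => ->.
apply: eq_bigr => -[[i j] k] _; rewrite hom_inj_completeE /=.
rewrite (_ : [forall v, _] = edge_in x i j && edge_in x j k && edge_in x i k).
  by case: (_ && _).
apply/forallP/idP => [H|/andP[/andP[ij jk] ik] v].
  have E v w := forallP (H v) w.
  by have := E o0 o1; have := E o1 o2; have := E o0 o2; rewrite !ffunE /= => -> -> ->.
apply/forallP => w; apply/implyP; rewrite !ffunE.
by case: (I3 v) => ->; case: (I3 w) => -> //= _; rewrite // edge_in_sym.
Qed.

Lemma Delta_t1 e x : Delta (@t1 R n) e x = 2.
Proof.
rewrite /Delta /t1 !tcount_single_edge -sumrB.
under eq_bigr do rewrite -sumrB.
rewrite -[RHS]/(1 + 1) -(sum_joins e (fun _ _ => 1)).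
apply: eq_bigr => i _; apply: eq_bigr => j _; rewrite !edge_in_set.
by case: joins; rewrite ?subrr ?subr0 ?mul0r ?mulr1.
Qed.

(** The edge [e] is at most one of the three sides of a triangle; toggling it matters exactly when
    the other two sides are present. *)
Lemma Delta_triangle e x i j k (D := joins e) (A := edge_in x)
    (B := fun b => edge_in (set_coord x e b)) :
  (B true i j && B true j k && B true i k)%:R -
  (B false i j && B false j k && B false i k)%:R =
  (D i j)%:R * ((A i k)%:R * (A j k)%:R) +
  ((D j k)%:R * ((A j i)%:R * (A k i)%:R) +
  (D i k)%:R * ((A i j)%:R * (A k j)%:R)) :> R.
Proof.
rewrite /B /A /D !edge_in_set (edge_in_sym x j i) (edge_in_sym x k i).
rewrite (edge_in_sym x k j).
have [->|ij] := eqVneq i j.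
  by rewrite edge_in_irr joins_irr /= !mul0r !mulr0 subrr !addr0.
have [->|jk] := eqVneq j k.
  by rewrite edge_in_irr joins_irr !andbF /= !mul0r !mulr0 subrr !addr0.
have [->|ik] := eqVneq i k.
  by rewrite edge_in_irr joins_irr !andbF /= !mul0r !mulr0 subrr !addr0.
have X1 : joins e i j -> joins e j k = false.
  move=> E; apply/negP => /(joins_cases E)[[h _]|[h _]].
    by rewrite h eqxx in ij.
  by rewrite h eqxx in ik.
have X2 : joins e i j -> joins e i k = false.
  move=> E; apply/negP => /(joins_cases E)[[_ h]|[h _]].
    by rewrite h eqxx in jk.
  by rewrite h eqxx in ik.
have X3 : joins e j k -> joins e i k = false.
  move=> E; apply/negP => /(joins_cases E)[[h _]|[h _]].
    by rewrite h eqxx in ij.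
  by rewrite h eqxx in jk.
case: ifP X1 X2 => [_ /(_ isT) -> /(_ isT) ->|_ _ _].
  by case: (edge_in x j k); case: (edge_in x i k); rewrite /=; ring.
case: ifP X3 => [_ /(_ isT) ->|_ _].
  by case: (edge_in x i j); case: (edge_in x i k); rewrite /=; ring.
by case: ifP => _; case: (edge_in x i j); case: (edge_in x j k);
  case: (edge_in x i k); rewrite /=; ring.
Qed.

(** The factor 6 is three positions of [e] in the triangle times two orientations. *)
Lemma Delta_t2 e x : Delta (@t2 R n) e x = 6 * (codegree e x)%:R / n%:R.
Proof.
rewrite /Delta /t2 -mulrBl; congr (_ / _); rewrite !tcount_triangle.
pose T u v w : R := (joins e u v)%:R * ((edge_in x u w)%:R * (edge_in x v w)%:R).
have S : \sum_u \sum_v \sum_w T u v w = 2 * (codegree e x)%:R.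
  under eq_bigr => u _ do under eq_bigr => v _ do rewrite -mulr_sumr.
  have e21 : joins e (val e).2 (val e).1 by rewrite joins_sym joins_val.
  rewrite sum_joins -(codegreeE x (joins_val e)) -(codegreeE x e21).
  by rewrite mulr_natl mulr2n.
transitivity (\sum_i \sum_j \sum_k T i j k +
  (\sum_i \sum_j \sum_k T j k i + \sum_i \sum_j \sum_k T i k j)).
  rewrite -!big_split -sumrB; apply: eq_bigr => i _.
  rewrite -!big_split -sumrB; apply: eq_bigr => j _.
  rewrite -!big_split -sumrB; apply: eq_bigr => k _.
  exact: Delta_triangle.
have -> : \sum_i \sum_j \sum_k T j k i = \sum_u \sum_v \sum_w T u v w.
  rewrite exchange_big; apply: eq_bigr => j _; exact: exchange_big.
have -> : \sum_i \sum_j \sum_k T i k j = \sum_u \sum_v \sum_w T u v w.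
  by apply: eq_bigr => i _; exact: exchange_big.
by rewrite S; ring.
Qed.

Lemma sum_Delta_codegree e x : (2 <= n)%N ->
  \sum_f `|Delta (fun y => (codegree f y)%:R) e x| <= 2 * (n - 2)%:R :> R.
Proof.
move=> n2.
(* [H i j] is 1 if [e] contains [i] but not [j], and 0 otherwise for [i != j]: only an edge sharing
   exactly one end point with [e] has its codegree changed, by at most 1. *)
pose H i j : R := \sum_(k | (k != i) && (k != j)) (joins e i k)%:R.
pose G i j : R := H i j + H j i.
have GE f : `|Delta (fun y => (codegree f y)%:R) e x| <= G (val f).1 (val f).2.
  set i := (val f).1; set j := (val f).2.
  rewrite /Delta !(codegreeE _ (joins_val f)) -/i -/j -sumrB.
  rewrite (bigID (fun k => (k != i) && (k != j))) /= [X in _ + X]big1 => [|k]; last first.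
    rewrite negb_and !negbK => /orP[]/eqP ->; rewrite !edge_in_irr.
      by rewrite !mul0r subrr.
    by rewrite !mulr0 subrr.
  rewrite addr0; apply: le_trans (ler_norm_sum _ _ _) _.
  rewrite /G /H [X in _ + X](eq_bigl (fun k => (k != i) && (k != j))); last first.
    by move=> k; rewrite andbC.
  rewrite -big_split; apply: ler_sum => k _ /=; rewrite !edge_in_set.
  case: (joins e i k); case: (joins e j k); case: (edge_in x i k);
    case: (edge_in x j k); rewrite /= ?(mulr0, mul0r, mulr1, subrr, subr0);
    by rewrite ?normr0 ?normr1; lra.
apply: le_trans (ler_sum _ (fun f _ => GE f)) _.
rewrite -(ler_pM2l (_ : 0 < 2 :> R))// -sum_pairs_coord; last first.
  by move=> i j; rewrite /G addrC.
have HS : \sum_i \sum_(j | i != j) H i j = 2 * (n - 2)%:R.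
  transitivity (\sum_i \sum_k (joins e i k)%:R * (n - 2)%:R : R); last first.
    by rewrite sum_joins mulr_natl mulr2n.
  apply: eq_bigr => i _.
  rewrite (exchange_big_dep (fun k => k != i)) /=; last by move=> j k _ /andP[].
  rewrite [RHS](bigID (fun k => k != i)) /= [X in _ = _ + X]big1 ?addr0; last first.
    move=> k /negPn/eqP ->; case: (boolP (joins e i i)) => [/joins_neq|].
      by rewrite eqxx.
    by rewrite mul0r.
  apply: eq_bigr => k ki; rewrite sumr_const -[LHS]mulr_natr; congr (_ * _%:R).
  have := cardsC [set i; k]; rewrite cards2 eq_sym ki card_ord => C.
  rewrite -[X in (X - _)%N]C.
  rewrite addKn; apply: eq_card => j; rewrite !inE negb_or /=.
  by rewrite (eq_sym j) (eq_sym j k).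
rewrite (eq_bigr (fun i => \sum_(j | i != j) H i j + \sum_(j | i != j) H j i)).
  rewrite big_split /= HS [X in _ + X](exchange_big_dep predT) //=.
  rewrite (eq_bigr (fun j => \sum_(i | j != i) H j i)) ?HS; last first.
    by move=> j _; apply: eq_bigl => i; rewrite eq_sym.
  by lra.
by move=> i _; rewrite -big_split.
Qed.

End Counts.

(** * Codegrees under the Erdos-Renyi law *)

Section ErdosRenyi.
Variables (R : realType) (n : nat).
Implicit Types (e f : Defs.coord n) (x : lgraph n) (i j k : 'I_n).

Lemma er_pmf_ge0 (a : R) x : 0 <= a <= 1 -> 0 <= er_pmf a x.
Proof.
move=> /andP[a0 a1]; apply: prodr_ge0 => e _; rewrite /bernoulli_pmf.
by case: ifP => _ //; rewrite subr_ge0.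
Qed.

Lemma mean_er_prod (a : R) (A : {set Defs.coord n}) :
  mean (er_pmf a) (fun x => \prod_(f in A) (x f)%:R) = a ^+ #|A|.
Proof.
rewrite /mean /er_pmf.
transitivity (\sum_(x : lgraph n) \prod_e
    (bernoulli_pmf a (x e) * (if e \in A then (x e)%:R else 1))).
  by apply: eq_bigr => x _; rewrite big_split [X in _ * X]big_mkcond.
rewrite -(bigA_distr_bigA (fun e b => bernoulli_pmf a b *
  (if e \in A then b%:R else 1))) /=.
rewrite -prodr_const [RHS]big_mkcond; apply: eq_bigr => e _; rewrite big_bool /=.
by case: (e \in A); rewrite ?mulr0 ?mulr1 ?addr0 // addrC subrK.
Qed.

Lemma mean_er1 (a : R) : mean (er_pmf a) (fun _ : lgraph n => 1) = 1.
Proof.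
rewrite -[RHS](expr0 a) -(cards0 (Defs.coord n)) -mean_er_prod.
by congr mean; apply/funext => x; rewrite big_set0.
Qed.

Lemma er_reversible (a : R) : reversible (er_pmf a) (fun _ (_ : lgraph n) => a).
Proof.
move=> e x; rewrite /er_pmf (bigD1 e) //= [in RHS](bigD1 e) //= !set_coordE eqxx /=.
rewrite (eq_bigr (fun f => bernoulli_pmf a (set_coord x e false f))).
  by rewrite [LHS]mulrAC [RHS]mulrAC; congr (_ * _); rewrite mulrC.
by move=> f fe; rewrite !set_coordE (negPf fe).
Qed.

Section Codegree.
Variables (e : Defs.coord n) (i j : 'I_n).
Hypothesis eij : joins e i j.

(** The two edges from [k] to the end points of [e]. For distinct [inner] vertices these sets are
    disjoint, so the codegree is a sum of independent indicators. *)
Let spokes k := [set f | joins f i k || joins f j k].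
Let inner := [pred k | (k != i) && (k != j)].

Lemma spokesE x k : inner k ->
  (edge_in x i k)%:R * (edge_in x j k)%:R = \prod_(f in spokes k) (x f)%:R :> R
  /\ #|spokes k| = 2%N.
Proof.
move=> /andP[ki kj]; have ij := joins_neq eij.
have [f fik] : {f | joins f i k} by apply: joins_ex; rewrite eq_sym.
have [g gjk] : {g | joins g j k} by apply: joins_ex; rewrite eq_sym.
have fg : f != g.
  apply/eqP => E; rewrite -E in gjk.
  case: (joins_cases fik gjk) => -[h _]; first by rewrite h eqxx in ij.
  by rewrite h eqxx in ki.
have -> : spokes k = [set f; g].
  apply/setP => h; rewrite !inE; apply/orP/orP => -[].
  - by move=> /joins_inj/(_ fik) ->; left.
  - by move=> /joins_inj/(_ gjk) ->; right.
  - by move=> /eqP ->; left.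
  - by move=> /eqP ->; right.
rewrite cards2 fg; split=> //.
by rewrite big_setU1 ?inE// big_set1 (edge_inE x fik) (edge_inE x gjk).
Qed.

Lemma spokes_disjoint k l : inner k -> inner l -> k != l ->
  [disjoint spokes k & spokes l].
Proof.
move=> /andP[ki kj] /andP[li lj] kl; rewrite -setI_eq0; apply/eqP/setP => f.
have ij := joins_neq eij.
rewrite !inE; apply/negP => /andP[/orP[] h1 /orP[] h2];
  case: (joins_cases h1 h2) => -[] E1 E2; subst;
  by rewrite ?eqxx in ki kj li lj kl ij.
Qed.

Lemma codegree_spokes x :
  (codegree e x)%:R = \sum_(k | inner k) \prod_(f in spokes k) (x f)%:R :> R.
Proof.
rewrite (codegreeE R x eij) (bigID inner) /= [X in _ + X]big1 ?addr0 => [|k].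
  by apply: eq_bigr => k /(spokesE x)[].
rewrite negb_and !negbK => /orP[]/eqP ->; rewrite edge_in_irr ?mul0r//.
by rewrite mulr0.
Qed.

Lemma card_inner : #|inner| = (n - 2)%N.
Proof.
have := cardsC [set i; j]; rewrite cards2 (joins_neq eij) card_ord => C.
rewrite -[X in (X - _)%N]C.
by rewrite addKn; apply: eq_card => k; rewrite !inE negb_or.
Qed.

Lemma mean_er_codegree (a : R) :
  mean (er_pmf a) (fun x => (codegree e x)%:R) = (n - 2)%:R * a ^+ 2.
Proof.
rewrite (_ : (fun x => _) = (fun x => \sum_(k | inner k)
   \prod_(f in spokes k) (x f)%:R)); last by apply/funext => x; exact: codegree_spokes.
rewrite mean_sumr (eq_bigr (fun=> a ^+ 2)) => [|k ik].
  by rewrite sumr_const card_inner mulr_natl.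
by rewrite mean_er_prod (spokesE [ffun=> false] ik).2.
Qed.

(** Diagonal pairs involve 2 edges and give [a ^+ 2]; off-diagonal pairs involve 4 distinct edges
    and give [a ^+ 4]. *)
Lemma mean_er_codegree_sq (a : R) : (2 < n)%N ->
  mean (er_pmf a) (fun x => (codegree e x)%:R ^+ 2) =
    (n - 2)%:R * (a ^+ 2 + ((n - 2)%:R - 1) * a ^+ 4).
Proof.
move=> n2.
rewrite (_ : (fun x => _) = (fun x => \sum_(k | inner k) \sum_(l | inner l)
   \prod_(f in spokes k :|: spokes l) (x f)%:R)); last first.
  apply/funext => x; rewrite codegree_spokes expr2 big_distrlr.
  apply: eq_bigr => k ik; apply: eq_bigr => l il.
  have [->|kl] := eqVneq k l; last first.
    rewrite [RHS](eq_bigl (mem [predU spokes k & spokes l])) => [|f].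
      by rewrite bigU ?spokes_disjoint.
    by rewrite !inE.
  rewrite finset.setUid -[LHS]big_split; apply: eq_bigr => f _ /=.
  by case: (x f); rewrite ?mulr1 ?mulr0.
rewrite mean_sumr (eq_bigr (fun=> a ^+ 2 + ((n - 2)%:R - 1) * a ^+ 4)) => [|k ik].
  by rewrite sumr_const card_inner mulr_natl.
have c2 l : inner l -> #|spokes l| = 2%N.
  by move=> il; exact: (spokesE [ffun=> false] il).2.
rewrite mean_sumr (bigD1 k) //= finset.setUid mean_er_prod c2//; congr (_ + _).
rewrite (eq_bigr (fun=> a ^+ 4)) => [|l /andP[il lk]]; last first.
  rewrite mean_er_prod cardsU.
  rewrite (finset.disjoint_setI0 (spokes_disjoint ik il _)) ?[k == l]eq_sym//.
  by rewrite cards0 !c2.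
rewrite sumr_const -[LHS]mulr_natl; congr (_ * _).
rewrite (_ : #|_| = (n - 2).-1); first by rewrite -subn1 natrB// subn_gt0.
rewrite -card_inner [in RHS](cardD1 k) (_ : k \in inner) //=.
by apply: eq_card => l; rewrite !inE andbC.
Qed.

(** Variance plus squared bias: the mean of the codegree differs from [n * a ^+ 2] by
    [- 2 * a ^+ 2], whose square is the term [4 * a ^+ 4]. *)
Lemma mean_er_codegree_dev (a : R) : (2 < n)%N ->
  mean (er_pmf a) (fun x => ((codegree e x)%:R / n%:R - a ^+ 2) ^+ 2) =
    ((n - 2)%:R * (a ^+ 2 * (1 - a ^+ 2)) + 4 * a ^+ 4) / n%:R ^+ 2.
Proof.
move=> n2.
rewrite (_ : (fun x => _) = (fun x => (codegree e x)%:R ^+ 2 * n%:R ^- 2 +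
   ((codegree e x)%:R * (- 2 * a ^+ 2 / n%:R) + 1 * a ^+ 4))); last first.
  by apply/funext => x; field; rewrite pnatr_eq0; lia.
rewrite !mean_add !mean_mulr mean_er1 mean_er_codegree_sq// mean_er_codegree.
have -> : n%:R = (n - 2)%:R + 2 :> R by rewrite -natrD subnK// ltnW.
by field; rewrite gt_eqF ?ltr_wpDl ?ler0n.
Qed.

End Codegree.
End ErdosRenyi.

(** * Exponential random graphs *)

Section Expectation.
Variables (R : realType) (n : nat).

Lemma expectation_has_law d (T : measurableType d) (P : probability T R)
    (X : T -> lgraph n) (p h : lgraph n -> R) : has_law P X p ->
  ('E_P[h \o X] = (mean p h)%:E)%E.
Proof.
move=> law.
have E w : (h \o X) w = \sum_x h x * \1_(X @^-1` [set x])%classic w.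
  rewrite (bigD1 (X w)) //= big1 ?addr0 => [|x xw].
    by rewrite indicE mem_set ?mulr1.
  rewrite indicE memNset ?mulr0// => Xw; move/eqP: xw; apply.
  by rewrite -Xw.
rewrite unlock.
rewrite (eq_integral (fun w => \sum_x (h x)%:E * (\1_(X @^-1` [set x])%classic w)%:E)%E).
  rewrite integral_sum//= => [|x]; last first.
    apply: integrableZl => //; apply: integrable_indic; exact: (law x).1.
  rewrite /mean -sumEFin; apply: eq_bigr => x _.
  rewrite integralZl//; last by apply: integrable_indic; exact: (law x).1.
  rewrite integral_indic//; last exact: (law x).1.
  rewrite classical_sets.setIT mulrC EFinM; congr (_ * _)%E.
  exact: (law x).2.
by move=> w _; rewrite E -sumEFin; apply: eq_bigr => x _; rewrite EFinM.
Qed.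

Lemma Delta_norm_ub (h : lgraph n -> R) e x : `|Delta h e x| <= Delta_norm h.
Proof.
apply: ub_le_sup; last by exists e => //; exists x.
(* [sup] dominates its set only once that set is known to be bounded; the sum of all the values is a
   bound. *)
exists (\sum_f \sum_y `|Delta h f y|) => _ [f _ [y _ <-]].
rewrite (bigD1 f) //= (bigD1 y) //= -addrA lerDl addr_ge0 ?sumr_ge0// => g _.
by rewrite sumr_ge0.
Qed.

(** Jensen's inequality, from the nonnegativity of the variance of [|h|]. *)
Lemma mean_norm_le (p : lgraph n -> R) h c : (forall x, 0 <= p x) ->
    mean p (fun=> 1) = 1 -> 0 <= c -> mean p (fun x => h x ^+ 2) <= c ^+ 2 ->
  mean p (fun x => `|h x|) <= c.
Proof.
move=> p0 p1 c0 hc; set t := mean p _.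
have t0 : 0 <= t by apply: sumr_ge0 => x _; rewrite mulr_ge0.
suff : t ^+ 2 <= c ^+ 2 by rewrite ler_sqr.
apply: le_trans hc; rewrite -subr_ge0.
have : 0 <= mean p (fun x => (`|h x| - t) ^+ 2).
  by apply: sumr_ge0 => x _; rewrite mulr_ge0 ?sqr_ge0.
rewrite (_ : (fun x => _) = (fun x => h x ^+ 2 + (`|h x| * (- 2 * t) + 1 * t ^+ 2))).
  by rewrite !mean_add !mean_mulr p1 -/t => H; lra.
by apply/funext => x; rewrite -(real_normK (num_real (h x))); ring.
Qed.

End Expectation.

(** * The ERGM as a stationary law and its distance from the Erdos-Renyi dynamics *)

Section ERGM.
Variables (R : realType) (n : nat) (beta1 beta2 : R).
Hypothesis n2 : (2 < n)%N.

Definition ergm_site (e : Defs.coord n) (x : lgraph n) : R :=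
  logistic (beta1 + 3 * beta2 * ((codegree e x)%:R / n%:R)).

Lemma ergm_site_free : site_free ergm_site.
Proof. by move=> e x b; rewrite /ergm_site codegree_set. Qed.

Lemma kappa_gt0 : 0 < kappa n beta1 beta2.
Proof.
rewrite /kappa (bigD1 [ffun=> false]) //= ltr_pwDl ?expR_gt0//.
by apply: sumr_ge0 => x _; rewrite expR_ge0.
Qed.

Lemma ergm_pmf_ge0 (x : lgraph n) : 0 <= ergm_pmf beta1 beta2 x.
Proof. by rewrite mulr_ge0 ?expR_ge0// invr_ge0 ltW ?kappa_gt0. Qed.

Lemma mean_ergm1 : mean (ergm_pmf beta1 beta2) (fun _ : lgraph n => 1) = 1.
Proof.
rewrite /mean; under eq_bigr do rewrite mulr1.
by rewrite -mulr_sumr mulVf// gt_eqF ?kappa_gt0.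
Qed.

(** By [Delta_t1] and [Delta_t2], adding [e] multiplies the weight by [expR (2 * u)], which is the
    odds of [logistic u]. *)
Lemma ergm_reversible : reversible (@ergm_pmf R n beta1 beta2) ergm_site.
Proof.
move=> e x; set u := beta1 + 3 * beta2 * ((codegree e x)%:R / n%:R).
have : ergm_weight beta1 beta2 (set_coord x e true) =
    ergm_weight beta1 beta2 (set_coord x e false) * (expR u * expR u).
  have := Delta_t1 R e x; have := Delta_t2 R e x; rewrite /Delta => H2 H1.
  rewrite /ergm_weight -!expRD; congr expR.
  move/eqP: H1; rewrite subr_eq => /eqP ->.
  move/eqP: H2; rewrite subr_eq => /eqP ->.
  by rewrite /u; ring.
rewrite /ergm_pmf /ergm_site -/u logisticE expRN.
move: (kappa _ _ _)^-1 (ergm_weight _ _ _) (ergm_weight _ _ _) => k w1 w0 ->.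
by field; rewrite !gt_eqF ?expR_gt0// addr_gt0 ?mulr_gt0 ?expR_gt0 ?ltr01.
Qed.

(** The product of the Lipschitz constant 1/2, the slope [3 * |beta2| / n], and the total codegree
    change [2 * (n - 2)]. *)
Lemma ergm_influence e (x : lgraph n) :
  \sum_f `|Delta (ergm_site f) e x| <= 3 * `|beta2| * (n - 2)%:R / n%:R.
Proof.
have n0 : 0 < n%:R :> R by rewrite ltr0n; lia.
have H f : `|Delta (ergm_site f) e x| <=
    3 * `|beta2| / (2 * n%:R) * `|Delta (fun y => (codegree f y)%:R) e x| :> R.
  apply: le_trans (logistic_lipschitz _ _) _.
  rewrite (_ : _ - _ = 3 * (beta2 / n%:R * Delta (fun y => (codegree f y)%:R) e x)).
    rewrite !normrM normfV (ger0_norm (_ : 0 <= 3))// (gtr0_norm n0).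
    rewrite le_eqVlt; apply/orP; left; apply/eqP; field.
    by rewrite gt_eqF.
  by rewrite /Delta; field; rewrite gt_eqF.
apply: le_trans (ler_sum _ (fun f _ => H f)) _.
rewrite -mulr_sumr.
have -> : 3 * `|beta2| * (n - 2)%:R / n%:R =
    3 * `|beta2| / (2 * n%:R) * (2 * (n - 2)%:R) by field; rewrite gt_eqF.
rewrite ler_wpM2l// ?divr_ge0 ?mulr_ge0 ?ler0n//.
by apply: sum_Delta_codegree; exact: ltnW.
Qed.

(* The deviation of [codegree / n] from [a^2] has a bias of order [1 / n]; it is
   absorbed by the gap between [1 - b] and the true contraction rate
   [1 - b (n - 2) / n], together with the smallness of the secant slope. *)
Lemma ergm_site_dev e a b : b = 3 * `|beta2| -> b < 1 -> a = phi beta1 beta2 a ->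
  mean (er_pmf a) (fun x => `|ergm_site e x - a|) <=
    (1 - b * (n - 2)%:R / n%:R) *
      (b / 2 * a * Num.sqrt (1 - a ^+ 2) / Num.sqrt (n - 2)%:R / (1 - b)).
Proof.
move=> bE b1 fix_a.
have b01 : 0 <= b < 1 by rewrite b1 bE mulr_ge0.
have [L [L0 L1 L2 main]] := exists_secant_slope (esym fix_a) b01.
have a01 : 0 < a < 1 by rewrite fix_a logistic_gt0 logistic_lt1.
case/andP: b01 a01 => b0 _ /andP[a0 a1].
have [m mE] : exists m, m = (n - 2)%:R :> R by eexists.
have m1 : 1 <= m by rewrite mE ler1n subn_gt0.
have nE : n%:R = m + 2 :> R by rewrite mE -natrD subnK// ltnW.
have c0 : 0 <= 1 - a ^+ 2 by rewrite subr_ge0 expr_le1 ?ltW.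
have dev x : (ergm_site e x - a) ^+ 2 <=
    ((codegree e x)%:R / n%:R - a ^+ 2) ^+ 2 * (L * b) ^+ 2.
  have w01 : 0 <= ((codegree e x)%:R / n%:R : R) <= 1.
    have n0 : 0 < n%:R :> R by rewrite ltr0n; lia.
    rewrite divr_ge0 ?ler0n//= ler_pdivrMr// mul1r ler_nat.
    by apply: leq_trans (codegree_le e x) _; exact: leq_subr.
  have := main _ w01 (3 * beta2); rewrite normrM (ger0_norm (_ : 0 <= 3))// -bE.
  move=> /(_ erefl); rewrite (_ : Phi _ _ _ + _ =
    beta1 + 3 * beta2 * ((codegree e x)%:R / n%:R)); last by rewrite /Phi; ring.
  rewrite -/(ergm_site e x) => H.
  rewrite -(real_normK (num_real (ergm_site e x - a))).
  rewrite -(real_normK (num_real (_ / _ - _))) -exprMn mulrC -mulrA.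
  by rewrite ler_pXn2r// nnegrE ?mulr_ge0.
apply: mean_norm_le => [x|||].
- by apply: er_pmf_ge0; rewrite !ltW.
- exact: mean_er1.
- rewrite -mE nE !mulr_ge0 ?invr_ge0 ?sqrtr_ge0//; try lra.
  rewrite subr_ge0 ler_pdivrMr; nra.
apply: (@le_trans _ _ (mean (er_pmf a)
    (fun x => ((codegree e x)%:R / n%:R - a ^+ 2) ^+ 2 * (L * b) ^+ 2))).
  apply: ler_sum => x _; rewrite ler_wpM2l//.
  by apply: er_pmf_ge0; rewrite !ltW.
rewrite mean_mulr (mean_er_codegree_dev (joins_val e) a n2) -mE nE.
have s0 : Num.sqrt m != 0 by rewrite sqrtr_eq0 -ltNge; lra.
have -> : ((1 - b * m / (m + 2)) *
    (b / 2 * a * Num.sqrt (1 - a ^+ 2) / Num.sqrt m / (1 - b))) ^+ 2 =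
  (b * a / 2 * (m + 2 - b * m)) ^+ 2 * Num.sqrt (1 - a ^+ 2) ^+ 2 /
    (Num.sqrt m ^+ 2 * ((m + 2) * (1 - b)) ^+ 2).
  by field; rewrite s0 !gt_eqF//; lra.
rewrite !sqr_sqrtr//; last by lra.
rewrite ler_pdivlMr; last first.
  by rewrite mulr_gt0 ?exprn_gt0 ?mulr_gt0//; lra.
(* Both sides share the factor [(b * a / 2) ^+ 2]; what remains is [variance_bias_bound] with
   [l = (2 * L) ^+ 2] and [p = m * (1 - b)], where [m + 2 - b * m = p + 2]. *)
have -> : (m * (a ^+ 2 * (1 - a ^+ 2)) + 4 * a ^+ 4) / (m + 2) ^+ 2 *
   (L * b) ^+ 2 * (m * ((m + 2) * (1 - b)) ^+ 2) =
   (b * a / 2) ^+ 2 * ((2 * L) ^+ 2 * ((m * (1 - b)) ^+ 2 * (1 - a ^+ 2) +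
      4 * a ^+ 2 * (1 - b) * (m * (1 - b)))).
  by field; rewrite gt_eqF//; lra.
rewrite [leRHS](_ : _ = (b * a / 2) ^+ 2 *
    ((1 - a ^+ 2) * (m * (1 - b) + 2) ^+ 2)); last by ring.
rewrite ler_wpM2l ?sqr_ge0//; apply: variance_bias_bound => //.
- by rewrite b0 ltW.
- by rewrite mulr_ge0; lra.
- by rewrite !ltW.
- by rewrite sqr_ge0.
Qed.

End ERGM.

Theorem proposition1p12 (R : realType) (n : nat) (hn : (3 <= n)%N)
    (beta1 beta2 : R) (hbeta2 : `|beta2| < 1 / 3)
    (dX : measure_display) (TX : measurableType dX) (PX : probability TX R)
    (X : TX -> lgraph n) (hX : has_law PX X (ergm_pmf beta1 beta2)) :
  exists a : R,
    unique (fun b : R => 0 <= b <= 1 /\ b = phi beta1 beta2 b) a /\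
    forall (dZ : measure_display) (TZ : measurableType dZ)
        (PZ : probability TZ R) (Z : TZ -> lgraph n)
        (hZ : has_law PZ Z (er_pmf a)) (h : lgraph n -> R),
      (`| 'E_PX[h \o X] - 'E_PZ[h \o Z] |
        <= (Delta_norm h * 'C(n, 2)%:R * (4 * (1 - 3 * `|beta2|))^-1 *
            (6 * a * Num.sqrt (1 - a ^+ 2) * `|beta2| /
             Num.sqrt (n - 2)%:R))%:E)%E.
Proof.
have [a ua] := phi_fixpoint_unique beta1 hbeta2.
exists a; split=> // dZ TZ PZ Z hZ h; case: ua => -[a01 fix_a] _.
rewrite (expectation_has_law h hX) (expectation_has_law h hZ) lee_fin.
have n0 : 0 < n%:R :> R by rewrite ltr0n; lia.
have n2R : (n - 2)%:R < n%:R :> R by rewrite ltr_nat; lia.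
pose eps : R := 3 * `|beta2| * (n - 2)%:R / n%:R.
have b1 : 3 * `|beta2| < 1 by lra.
have eps01 : 0 <= eps < 1.
  rewrite /eps divr_ge0 ?mulr_ge0//= ltr_pdivrMr// mul1r.
  by apply: le_lt_trans n2R; rewrite ler_piMl// ltW.
have E0 : (0 < #|{: Defs.coord n}|)%N by rewrite card_coord bin_gt0; lia.
have site01 e x : 0 <= @ergm_site R n beta1 beta2 e x <= 1.
  by rewrite !ltW ?logistic_gt0 ?logistic_lt1.
have [e0 _] := card_gt0P E0.
have D0 : 0 <= Delta_norm h := le_trans (normr_ge0 _) (Delta_norm_ub h e0 [ffun=> false]).
apply: le_trans (glauber_comparison E0 (mean_ergm1 n beta1 beta2) (mean_er1 n a)
  (@ergm_pmf_ge0 R n beta1 beta2) (fun x => er_pmf_ge0 x a01)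
  (@ergm_reversible R n beta1 beta2) (@er_reversible R n a)
  (@ergm_site_free R n beta1 beta2) (fun _ _ _ => erefl) site01 eps01
  (@ergm_influence R n beta1 beta2 hn) (Delta_norm_ub h)) _.
have /andP[_ eps1] := eps01.
have D1 : 0 <= Delta_norm h / (1 - eps) by rewrite divr_ge0// subr_ge0 ltW.
apply: le_trans (ler_wpM2l D1 (ler_sum _ (fun e _ =>
  ergm_site_dev hn e erefl b1 fix_a))) _.
rewrite sumr_const card_coord -[X in _ * X]mulr_natr -/eps.
have s0 : Num.sqrt (n - 2)%:R != 0 :> R.
  by rewrite sqrtr_eq0 -ltNge ltr0n; lia.
(* The factor [1 - eps] cancels between the comparison and the deviation bound, and
   [3 * |beta2| / 2 = 6 * |beta2| / 4] yields the stated constant. *)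
rewrite le_eqVlt; apply/orP; left; apply/eqP.
by field; rewrite s0 !gt_eqF//; lra.
Qed.
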